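(* Let $r\geq 1$ be an integer, let $T=\langle \mathbf{p}_1,\mathbf{p}_2,\mathbf{p}_3\rangle\subset\mathbb{R}^2$ be a non-degenerate triangle, and let $\Delta_{\mathrm{CT}}$ be its (barycentric) Clough--Tocher 3-split. Let $\mathcal{Q}$ be any symmetric quadrature rule on $T$ of type $[n_0,n_1,n_2]$ that is exact on $\mathbb{P}_{3r}$, i.e. $\mathcal{Q}(f)=\int_T f(\mathbf{x})\,d\mathbf{x}$ for all $f\in\mathbb{P}_{3r}$. Then $\mathcal{Q}$ is exact on the spline space $\mathbb{S}^{2r-1}_{3r}(\Delta_{\mathrm{CT}})$, i.e. $\mathcal{Q}(s)=\int_T s(\mathbf{x})\,d\mathbf{x}$ for all $s\in \mathbb{S}^{2r-1}_{3r}(\Delta_{\mathrm{CT}})$.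
   Context: $\langle\cdot\rangle$ denotes the convex hull, and $A(T)$ the area of $T$. $\mathbb{P}_d$ is the space of real bivariate polynomials of total degree at most $d$. Clough--Tocher split: let $\mathbf{p}_c:=\frac13(\mathbf{p}_1+\mathbf{p}_2+\mathbf{p}_3)$ be the barycenter of $T$. $\Delta_{\mathrm{CT}}$ is the triangulation of $T$ consisting of the three closed triangles $\langle \mathbf{p}_1,\mathbf{p}_2,\mathbf{p}_c\rangle$, $\langle \mathbf{p}_2,\mathbf{p}_3,\mathbf{p}_c\rangle$, $\langle \mathbf{p}_3,\mathbf{p}_1,\mathbf{p}_c\rangle$. Spline space: for a triangulation $\Delta$ of $T$, $\mathbb{S}^\rho_d(\Delta)$ is the space of functions $s:T\to\mathbb{R}$ of class $C^\rho$ on $T$ such that $s|_\tau\in\mathbb{P}_d$ for every triangle $\tau\in\Delta$. Symmetric quadrature rule: for a triple $\boldsymbol{\alpha}=(\alpha_1,\alpha_2,\alpha_3)$ with $\alpha_1+\alpha_2+\alpha_3=1$, let $\mathbf{t}(\boldsymbol{\alpha})=\alpha_1\mathbf{p}_1+\alpha_2\mathbf{p}_2+\alpha_3\mathbf{p}_3$ be the point with barycentric coordinates $\boldsymbol{\alpha}$ with respect to $T$, and let $\Pi\{\beta_1,\beta_2,\beta_3\}$ be the set of all distinct permutations of the triple $(\beta_1,\beta_2,\beta_3)$. A symmetric quadrature rule of type $[n_0,n_1,n_2]$ (with $n_0\in\{0,1\}$ and integers $n_1,n_2\geq0$) is a functional of the form $$\mathcal{Q}(f)=A(T)\Bigl(\omega_0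 f\bigl(\mathbf{t}(\tfrac13,\tfrac13,\tfrac13)\bigr)+\sum_{i=1}^{n_1}\omega_{i,1}\sum_{\boldsymbol{\alpha}\in\Pi\{\theta_{i,1},\theta_{i,1},1-2\theta_{i,1}\}}f(\mathbf{t}(\boldsymbol{\alpha}))+\sum_{i=1}^{n_2}\omega_{i,2}\sum_{\boldsymbol{\alpha}\in\Pi\{\theta_{i,2},\eta_{i,2},1-\theta_{i,2}-\eta_{i,2}\}}f(\mathbf{t}(\boldsymbol{\alpha}))\Bigr),$$ with real weights, where the first term is absent if $n_0=0$, all nodes lie in $T$, $\theta_{i,1}\neq\frac13$, and $\theta_{i,2},\eta_{i,2},1-\theta_{i,2}-\eta_{i,2}$ are pairwise distinct. *)

(* Defs.v *)
From HB Require Import structures.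
From mathcomp Require Import all_boot all_order all_algebra.
From mathcomp Require Import all_classical all_reals all_analysis.

Set Implicit Arguments.
Unset Strict Implicit.
Unset Printing Implicit Defensive.

Import Order.TTheory GRing.Theory Num.Theory.
Import numFieldNormedType.Exports.

Local Open Scope classical_set_scope.
Local Open Scope ring_scope.

Section Defs.
Context {R : realType}.

(* The point [a_1 p1 + a_2 p2 + a_3 p3] of the plane, for a triple
   [a = [:: a_1; a_2; a_3]]. Triples are sequences so that [permutations] of
   seq.v, which lists the distinct permutations without repetition, applies. *)
Definition bary (p1 p2 p3 : R * R) (a : seq R) : R * R :=
  a`_0 *: p1 + a`_1 *: p2 + a`_2 *: p3.

Definition triangle (p1 p2 p3 : R * R) : set (R * R) :=
  [set x | exists a1 a2 a3 : R,
    [/\ 0 <= a1, 0 <= a2, 0 <= a3, a1 + a2 + a3 = 1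
      & x = bary p1 p2 p3 [:: a1; a2; a3]]].

Definition nondegenerate_triangle (p1 p2 p3 : R * R) : bool :=
  free [:: p2 - p1; p3 - p1].

Definition mu2 := (@lebesgue_measure R \x @lebesgue_measure R)%E.

Definition area (T : set (R * R)) : R := fine (mu2 T).

Definition integral2 (T : set (R * R)) (f : R * R -> R) : R :=
  \int[mu2]_(x in T) f x.

Definition Pd (d : nat) : set (R * R -> R) :=
  [set f | exists c : nat -> nat -> R, f = fun x : R * R =>
    \sum_(i < d.+1) \sum_(j < d.+1 | (i + j <= d)%N)
      c i j * x.1 ^+ i * x.2 ^+ j].

(* [s] is of class C^k on the set T: its partial derivatives of order at most k
   exist in the interior of T and extend continuously to T. Only the values of
   [s] on T matter. [g1] and [g2] are the extended partial derivatives. *)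
Fixpoint class_C (k : nat) (T : set (R * R)) (s : R * R -> R) : Prop :=
  match k with
  | 0%N => {within T, continuous s}
  | k'.+1 => {within T, continuous s} /\
      exists g1 g2 : R * R -> R,
        [/\ forall x, T^° x -> is_derive x ((1, 0) : R * R) s (g1 x),
            forall x, T^° x -> is_derive x ((0, 1) : R * R) s (g2 x),
            class_C k' T g1 & class_C k' T g2]
  end.

(* Functions on T are represented by functions on the plane, considered only
   through their values on T. *)
Definition spline_space (rho d : nat) (T : set (R * R))
    (Delta : set (set (R * R))) : set (R * R -> R) :=
  [set s | class_C rho T s /\
    forall tau, Delta tau -> exists2 p, Pd d p & forall x, tau x -> s x = p x].

Definition barycenter (p1 p2 p3 : R * R) : R * R := 3^-1 *: (p1 + p2 + p3).

Definition CT_split (p1 p2 p3 : R * R) : set (set (R * R)) :=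
  let pc := barycenter p1 p2 p3 in
  [set triangle p1 p2 pc; triangle p2 p3 pc; triangle p3 p1 pc].

Definition orbit_sum (p1 p2 p3 : R * R) (b : seq R) (f : R * R -> R) : R :=
  \sum_(a <- permutations b) f (bary p1 p2 p3 a).

Definition orbit_in (p1 p2 p3 : R * R) (b : seq R) : Prop :=
  forall a, a \in permutations b -> triangle p1 p2 p3 (bary p1 p2 p3 a).

Definition type1 (theta : R) : seq R := [:: theta; theta; 1 - theta *+ 2].

Definition type2 (theta eta : R) : seq R := [:: theta; eta; 1 - theta - eta].

Definition symmetric_rule (p1 p2 p3 : R * R) (n0 n1 n2 : nat)
    (Q : (R * R -> R) -> R) : Prop :=
  (n0 <= 1)%N /\
  exists (w0 : R) (w1 theta1 : 'I_n1 -> R) (w2 theta2 eta2 : 'I_n2 -> R),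
  [/\ forall i, theta1 i != 3^-1 /\ orbit_in p1 p2 p3 (type1 (theta1 i)),
      forall i, uniq (type2 (theta2 i) (eta2 i)) /\
                orbit_in p1 p2 p3 (type2 (theta2 i) (eta2 i))
    & forall f, Q f = area (triangle p1 p2 p3) *
        ((if n0 == 0%N then 0
          else w0 * f (bary p1 p2 p3 [:: 3^-1; 3^-1; 3^-1]))
         + \sum_(i < n1) w1 i * orbit_sum p1 p2 p3 (type1 (theta1 i)) f
         + \sum_(i < n2)
             w2 i * orbit_sum p1 p2 p3 (type2 (theta2 i) (eta2 i)) f)].

Definition exact_on (Q : (R * R -> R) -> R) (T : set (R * R))
    (F : set (R * R -> R)) : Prop :=
  forall f, F f -> Q f = integral2 T f.

End Defs.

(* Main.v *)
Require Import Defs.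
From mathcomp Require Import all_boot all_order all_algebra all_fingroup.
From mathcomp Require Import all_classical all_reals all_analysis.
From mathcomp Require Import measurable_realfun.
From mathcomp Require Import ring lra zify.

(** Let [l_i] be the barycentric coordinates of the triangle [T]. A permutation
    [s] of the vertices induces an affine map [S_s] of the plane preserving [T].
    These maps permute the nodes of each orbit of the rule
    ([rule_vertex_map]) and preserve area ([area_preserving_vertex_map],
    [integral_vertex_map]), so the rule and the integral both take the same
    value on a spline [f] and on every [f \o S_s]. Hence it suffices that the
    symmetrized spline [\sum_s f \o S_s] coincides on [T] with a polynomial of
    degree at most [3r], where the rule is exact ([sum_vertex_map_Pd]).

    Index the pieces of [f] so that [g_i] is the polynomial carried by the
    subtriangle opposite to vertex [i], where [l_i] is the smallest coordinate.
    Smoothness of order [2r-1] across the interior edge [l_i = l_j] says that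
    [(l_i - l_j)^(2r)] divides [g_i - g_j] ([smooth_division]). Let [G_i] be the
    pieces of the symmetrized spline. The difference [G_i - G_j] changes sign when
    the vertices [i] and [j] are exchanged, and so does [l_i - l_j], whose even
    power is thus multiplied by an antisymmetric cofactor, which vanishes on the
    fixed line [l_i = l_j]. So one more factor comes for free
    ([symmetrized_sub]):
      [G_i - G_j = (l_i - l_j)^(2r+1) * f_ij]  with  [deg f_ij <= r - 1].

    The three differences add up to zero, and there is no room for such an
    identity ([symmetrized_eq]). On a line [l_i - l_j = c] with [c <> 0] it reads
    [A + B + C = 0], where [deg C < r], while [A] and [B] have degree at most
    [3r] and are divisible by [(X-a)^(2r+1)] and [(X-b)^(2r+1)] with [a <> b].
    Differentiating [r] times removes [C] and leaves a polynomial of degree at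
    most [2r] divisible by [(X-a)^(r+1) * (X-b)^(r+1)], which must be zero
    ([three_powers_eq0]). Therefore all [G_i] agree. *)

Set Implicit Arguments.
Unset Strict Implicit.
Unset Printing Implicit Defensive.

Import Order.TTheory GRing.Theory Num.Theory.
Import numFieldNormedType.Exports.

Local Open Scope classical_set_scope.
Local Open Scope ring_scope.

(** * Polynomial functions of two variables *)

Section BivariatePolynomials.
Context {R : realType}.
Implicit Types (f g h l : R * R -> R) (d m n : nat).

Lemma sum_closed (K : (R * R -> R) -> Prop) :
  K (fun=> 0) -> (forall f g, K f -> K g -> K (fun x => f x + g x)) ->
  forall (I : Type) (s : seq I) (P : pred I) (F : I -> R * R -> R),
    (forall i, P i -> K (F i)) -> K (fun x => \sum_(i <- s | P i) F i x).
Proof.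
move=> K0 KD I s P F KF; elim: s => [|i s IHs].
  by rewrite (_ : (fun _ => _) = fun=> 0)//; apply/funext => x; rewrite big_nil.
rewrite (_ : (fun _ => _) = fun x => (if P i then F i else fun=> 0) x +
    \sum_(i <- s | P i) F i x); last first.
  by apply/funext => x; rewrite big_cons; case: ifP; rewrite ?add0r.
by apply: (KD _ (fun x => \sum_(i <- s | P i) F i x)) => //; case: ifP => // /KF.
Qed.

Lemma Pd_ind d (K : (R * R -> R) -> Prop) :
  K (fun=> 0) -> (forall f g, K f -> K g -> K (fun x => f x + g x)) ->
  (forall c i j, (i + j <= d)%N -> K (fun x => c * x.1 ^+ i * x.2 ^+ j)) ->
  forall f, Pd d f -> K f.
Proof.
move=> K0 KD Kmono _ [c ->].
apply: (@sum_closed K) => // i _; apply: (@sum_closed K) => // j ij.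
exact: Kmono.
Qed.

Lemma Pd_mono d c i j : (i + j <= d)%N ->
  Pd d (fun x : R * R => c * x.1 ^+ i * x.2 ^+ j).
Proof.
move=> ijd; exists (fun a b => if (a == i) && (b == j) then c else 0).
apply/funext => x.
have id : (i < d.+1)%N by rewrite ltnS (leq_trans _ ijd)// leq_addr.
have jd : (j < d.+1)%N by rewrite ltnS (leq_trans _ ijd)// leq_addl.
rewrite (bigD1 (Ordinal id))//= (bigD1 (Ordinal jd))//= !eqxx/=.
rewrite big1 ?addr0 => [|k /andP[_]]; last first.
  by rewrite -val_eqE/= => /negPf ->; rewrite !mul0r.
rewrite big1 ?addr0// => k; rewrite -val_eqE/= => /negPf ->.
by rewrite big1// => a _; rewrite !mul0r.
Qed.

Lemma Pd0 d : Pd d (fun=> 0 : R).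
Proof.
exists (fun _ _ => 0); apply/funext => x.
by rewrite big1// => i _; rewrite big1// => j _; rewrite !mul0r.
Qed.

Lemma PdD d f g : Pd d f -> Pd d g -> Pd d (fun x => f x + g x).
Proof.
move=> [c ->] [c' ->]; exists (fun i j => c i j + c' i j); apply/funext => x.
rewrite -big_split; apply: eq_bigr => i _; rewrite -big_split.
by apply: eq_bigr => j _; rewrite !mulrDl.
Qed.

Lemma Pd_sum d (I : Type) (s : seq I) (P : pred I) (F : I -> R * R -> R) :
  (forall i, P i -> Pd d (F i)) -> Pd d (fun x => \sum_(i <- s | P i) F i x).
Proof. exact: sum_closed (@Pd0 d) (@PdD d) I s P F. Qed.

Lemma PdM m n f g : Pd m f -> Pd n g -> Pd (m + n) (fun x => f x * g x).
Proof.
move=> Pf Pg; move: f Pf; apply: Pd_ind => [|f f' Pf Pf'|c i j ijm].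
- by rewrite (_ : (fun _ => _) = fun=> 0); [exact: Pd0|apply/funext => x; rewrite mul0r].
- rewrite (_ : (fun _ => _) = fun x => f x * g x + f' x * g x); first exact: PdD.
  by apply/funext => x; rewrite mulrDl.
move: g Pg; apply: Pd_ind => [|g g' Pg Pg'|c' i' j' ijn].
- by rewrite (_ : (fun _ => _) = fun=> 0); [exact: Pd0|apply/funext => x; rewrite mulr0].
- rewrite (_ : (fun _ => _) = fun x => c * x.1 ^+ i * x.2 ^+ j * g x +
    c * x.1 ^+ i * x.2 ^+ j * g' x); first exact: PdD.
  by apply/funext => x; rewrite mulrDr.
rewrite (_ : (fun _ => _) = fun x => c * c' * x.1 ^+ (i + i') * x.2 ^+ (j + j')).
  by apply: Pd_mono; rewrite addnACA leq_add.
by apply/funext => x; rewrite !exprD; ring.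
Qed.

Lemma Pd_leq m n f : (m <= n)%N -> Pd m f -> Pd n f.
Proof.
move=> mn; move: f; apply: Pd_ind; [exact: Pd0|exact: PdD|move=> c i j ijm].
by apply: Pd_mono; exact: leq_trans mn.
Qed.

Lemma Pd_cst d c : Pd d (fun=> c : R).
Proof.
rewrite (_ : (fun _ => _) = fun x : R * R => c * x.1 ^+ 0 * x.2 ^+ 0).
  exact: Pd_mono.
by apply/funext => x; rewrite !expr0 !mulr1.
Qed.

Lemma PdZ d c f : Pd d f -> Pd d (fun x => c * f x).
Proof. exact: (@PdM 0 d _ _ (Pd_cst 0 c)). Qed.

Lemma PdB d f g : Pd d f -> Pd d g -> Pd d (fun x => f x - g x).
Proof.
move=> Pf Pg; have := PdD Pf (PdZ (-1) Pg).
by congr Pd; apply/funext => x; rewrite mulN1r.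
Qed.

Lemma PdX d n f : Pd d f -> Pd (n * d) (fun x => f x ^+ n).
Proof.
move=> Pf; elim: n => [|n IHn]; first exact: Pd_cst.
rewrite mulSn (_ : (fun _ => _) = fun x => f x * f x ^+ n); first exact: PdM.
by apply/funext => x; rewrite exprS.
Qed.

Lemma Pd1_affine a b c : Pd 1 (fun x : R * R => a * x.1 + b * x.2 + c).
Proof.
apply: PdD (Pd_cst _ _); apply: PdD.
- by have := @Pd_mono 1 a 1 0 isT; congr Pd; apply/funext => x; rewrite mulr1.
- by have := @Pd_mono 1 b 0 1 isT; congr Pd; apply/funext => x; rewrite mulr1.
Qed.

Lemma Pd1E l : Pd 1 l -> exists a b c, l = fun x => a * x.1 + b * x.2 + c.
Proof.
move: l; apply: Pd_ind => [|f g [a [b [c ->]]] [a' [b' [c' ->]]]|c [|[|i]] [|[|j]]//= _].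
- by exists 0, 0, 0; apply/funext => x; ring.
- by exists (a + a'), (b + b'), (c + c'); apply/funext => x; ring.
- by exists 0, 0, c; apply/funext => x; ring.
- by exists 0, c, 0; apply/funext => x; ring.
- by exists c, 0, 0; apply/funext => x; ring.
Qed.

Definition affine_map (A : R * R -> R * R) :=
  Pd 1 (fun x => (A x).1) /\ Pd 1 (fun x => (A x).2).

Lemma Pd_comp d f A : affine_map A -> Pd d f -> Pd d (f \o A).
Proof.
move=> [A1 A2]; move: f; apply: Pd_ind => [|f g|c i j ijd]; [exact: Pd0|exact: PdD|].
apply: (Pd_leq ijd); rewrite -[i]muln1 -[j]muln1.
have := PdM (PdZ c (PdX i A1)) (PdX j A2).
by congr Pd; apply/funext => x /=; rewrite !muln1.
Qed.

Lemma Pd_line d f (x w : R * R) : Pd d f ->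
  exists2 P : {poly R}, (size P <= d.+1)%N & forall t, f (x + t *: w) = P.[t].
Proof.
move: f; apply: Pd_ind => [|f g [P sP fP] [Q sQ gQ]|c i j ijd].
- by exists 0; [rewrite size_poly0|move=> t; rewrite horner0].
- exists (P + Q); first by rewrite (leq_trans (size_polyD _ _))// geq_max sP.
  by move=> t; rewrite hornerD fP gQ.
- exists (c *: (x.1%:P + w.1 *: 'X) ^+ i * (x.2%:P + w.2 *: 'X) ^+ j); last first.
    by move=> t; rewrite !hornerE/= [w.1 * t]mulrC [w.2 * t]mulrC.
  have size_aff (a b : R) : (size (a%:P + b *: 'X : {poly R})%R <= 2)%N.
    rewrite (leq_trans (size_polyD _ _))// geq_max.
    rewrite (leq_trans (size_polyC_leq1 _))//=.
    by rewrite (leq_trans (size_scale_leq _ _))// size_polyX.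
  have size_affX (a b : R) n : (size ((a%:P + b *: 'X : {poly R}) ^+ n)%R <= n.+1)%N.
    rewrite (leq_trans (size_poly_exp_leq _ _))// ltnS.
    by have := size_aff a b; case: size => [|[|[|]]]//= _; rewrite ?mul1n.
  rewrite (leq_trans (size_polyMleq _ _))//.
  rewrite (leq_trans (_ : _ <= (i.+1 + j.+1).-1)%N)//; last by lia.
  have s1 := leq_trans (size_scale_leq c _) (size_affX x.1 w.1 i).
  have s2 := size_affX x.2 w.2 j.
  by rewrite -!subn1 leq_sub2r// leq_add.
Qed.

Lemma poly_eq0_itv (P : {poly R}) :
  (forall t, 0 < t < 1 -> P.[t] = 0) -> P = 0.
Proof.
move=> P01; apply/eqP/negPn/negP => P0.
(* distinct points of the interval, one more than the degree of [P] *)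
pose s := [seq k.+2%:R^-1 : R | k <- iota 0 (size P)].
have := max_poly_roots P0 (rs := s); rewrite size_map size_iota ltnn => H.
suff : false by []; apply: H.
  apply/allP => _ /mapP[k _ ->]; rewrite rootE P01//.
  by rewrite invr_gt0 ltr0n/= invf_lt1 ?ltr0n// ltr1n.
rewrite map_inj_uniq ?iota_uniq// => a b /invr_inj/eqP.
by rewrite eqr_nat => /eqP[].
Qed.

Lemma Pd_eq0_line d f (x w : R * R) : Pd d f ->
  (forall t, 0 < t < 1 -> f (x + t *: w) = 0) ->
  forall t, f (x + t *: w) = 0.
Proof.
move=> Pf f0 t; have [P _ PE] := Pd_line x w Pf.
by rewrite PE (@poly_eq0_itv P) ?horner0// => u /f0; rewrite PE.
Qed.
End BivariatePolynomials.

(** * Division by affine forms *)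

Section Division.
Context {R : realType}.
Implicit Types (f g h l : R * R -> R) (d m n : nat).

Lemma Pd_decomp d f : Pd d.+1 f -> exists k f1 f2,
  [/\ Pd d f1, Pd d f2 & forall x, f x = k + x.1 * f1 x + x.2 * f2 x].
Proof.
move: f; apply: Pd_ind => [|f g [k [f1 [f2 [P1 P2 E]]]] [k' [g1 [g2 [Q1 Q2 E']]]]|].
- exists 0, (fun=> 0), (fun=> 0); split; [exact: Pd0|exact: Pd0|].
  by move=> x; rewrite !mulr0 !addr0.
- exists (k + k'), (fun x => f1 x + g1 x), (fun x => f2 x + g2 x).
  by split; [exact: PdD|exact: PdD|move=> x; rewrite E E'; ring].
move=> c [|i] [|j] ijd.
- exists c, (fun=> 0), (fun=> 0); split; [exact: Pd0|exact: Pd0|].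
  by move=> x; rewrite !expr0; ring.
- exists 0, (fun=> 0), (fun x => c * x.1 ^+ 0 * x.2 ^+ j).
  split; [exact: Pd0|exact: Pd_mono|].
  by move=> x; rewrite exprS; ring.
- exists 0, (fun x => c * x.1 ^+ i * x.2 ^+ 0), (fun=> 0).
  split; [by apply: Pd_mono|exact: Pd0|].
  by move=> x; rewrite exprS; ring.
- exists 0, (fun x => c * x.1 ^+ i * x.2 ^+ j.+1), (fun=> 0).
  split; [by apply: Pd_mono|exact: Pd0|].
  by move=> x; rewrite [x.1 ^+ _]exprS; ring.
Qed.

Lemma affine_map_shift l (n : R * R) (c : R) : Pd 1 l ->
  affine_map (fun x => x + (c * l x) *: n).
Proof.
move=> Pl; split => /=.
- have := PdD (Pd1_affine 1 0 0) (PdZ (c * n.1) Pl).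
  by congr Pd; apply/funext => -[x1 x2]; case: n => n1 n2 /=;
    rewrite /GRing.scale/=; ring.
- have := PdD (Pd1_affine 0 1 0) (PdZ (c * n.2) Pl).
  by congr Pd; apply/funext => -[x1 x2]; case: n => n1 n2 /=;
    rewrite /GRing.scale/=; ring.
Qed.

(** When [l] has slope 1 in the direction [n], the point [y = x - l x *: n] is the
    projection of [x] on the line [l = 0]. Both coordinates of [x - y] are
    multiples of [l x], so the telescoping
    [x.1 f1(x) - y.1 f1(y) = (x.1 - y.1) f1(x) + y.1 (f1(x) - f1(y))] raises the
    degree by one. *)
Lemma Pd_sub_proj d f l (n : R * R) : Pd 1 l -> Pd d.+1 f ->
  exists2 g, Pd d g & forall x, f x - f (x - l x *: n) = l x * g x.
Proof.
move=> Pl; elim: d f => [|d IHd] f Pf.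
  have [a [b [c ->]]] := Pd1E Pf.
  exists (fun=> a * n.1 + b * n.2); first exact: Pd_cst.
  by move=> [x1 x2]; case: n => n1 n2 /=; rewrite /GRing.scale/=; ring.
have [k [f1 [f2 [P1 P2 fE]]]] := Pd_decomp Pf.
have [g1 Pg1 g1E] := IHd _ P1; have [g2 Pg2 g2E] := IHd _ P2.
have [A1 A2] := affine_map_shift n (-1) Pl.
exists (fun x => (n.1 * f1 x + (x + (-1 * l x) *: n).1 * g1 x)
               + (n.2 * f2 x + (x + (-1 * l x) *: n).2 * g2 x)).
  by do 2 apply: PdD; [exact: PdZ|exact: (PdM A1)|exact: PdZ|exact: (PdM A2)].
move=> x; rewrite !fE mulN1r scaleNr.
move: (g1E x) (g2E x); set y := x - _.
have -> : y.1 = x.1 - l x * n.1 by [].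
have -> : y.2 = x.2 - l x * n.2 by [].
move=> e1 e2.
have -> : f1 x = f1 y + l x * g1 x by rewrite -e1 addrC subrK.
have -> : f2 x = f2 y + l x * g2 x by rewrite -e2 addrC subrK.
ring.
Qed.

(** The value subtracted in [Pd_sub_proj] is taken on the line [l = 0]. *)
Lemma Pd_div d f l (n : R * R) : Pd 1 l -> (forall x, l (x - l x *: n) = 0) ->
  Pd d.+1 f -> (forall x, l x = 0 -> f x = 0) ->
  exists2 g, Pd d g & forall x, f x = l x * g x.
Proof.
move=> Pl ln Pf f0; have [g Pg gE] := Pd_sub_proj n Pl Pf.
by exists g => // x; rewrite -gE (f0 _ (ln x)) subr0.
Qed.

Lemma dvdp_derivn (p q : {poly R}) n m :
  p ^+ (n + m) %| q -> p ^+ n %| q^`(m).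
Proof.
elim: m n q => [|m IHm] n q; first by rewrite addn0 derivn0.
rewrite -addSnnS => /IHm/dvdpP[u].
rewrite derivnS => ->; rewrite derivM deriv_exp exprS.
apply: dvdp_add; first by rewrite mulrA dvdp_mull.
by rewrite -mulr_natr dvdp_mull// dvdp_mulr// dvdp_mull.
Qed.

Lemma size_derivn (P : {poly R}) n : size P^`(n) = (size P - n)%N.
Proof.
apply/eqP; rewrite eqn_leq; apply/andP; split.
  apply/leq_sizeP => i; rewrite leq_subLR => Pi.
  by rewrite coef_derivn nth_default ?mul0rn.
rewrite leq_subLR; apply/leq_sizeP => i nPi.
have /leq_sizeP/(_ (i - n)%N) := leqnn (size P^`(n)).
rewrite coef_derivn subnKC; last by lia.
move=> /(_ ltac:(lia))/eqP; rewrite mulrn_eq0 => /orP[|/eqP//].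
by rewrite eqn0Ngt ffact_gt0; lia.
Qed.

(** The [r]-th derivative kills [C], so those of the first two terms are
    opposite. Both are then divisible by the coprime polynomials
    [(X-a)^(r+1)] and [(X-b)^(r+1)], whose product has degree [2r+2], although
    they have degree at most [2r]. So they vanish, and a multiple of
    [(X-a)^(2r+1)] whose [r]-th derivative vanishes is zero. *)
Lemma three_powers_eq0 (r : nat) (a b : R) (A B C : {poly R}) : a != b ->
  (size A <= r)%N -> (size B <= r)%N -> (size C <= r)%N ->
  ('X - a%:P) ^+ (2 * r).+1 * A + ('X - b%:P) ^+ (2 * r).+1 * B + C = 0 ->
  C = 0.
Proof.
move=> ab sA sB sC ABC.
set P := _ * A in ABC; set Q := _ * B in ABC.
have Er : ((2 * r).+1 = r.+1 + r)%N by lia.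
have dP : ('X - a%:P) ^+ r.+1 %| P^`(r).
  by apply: dvdp_derivn; rewrite -Er dvdp_mulr.
have dQ : ('X - b%:P) ^+ r.+1 %| Q^`(r).
  by apply: dvdp_derivn; rewrite -Er dvdp_mulr.
have PQ : Q^`(r) = - P^`(r).
  apply/eqP; rewrite -addr_eq0 addrC -derivnD.
  have -> : P + Q = - C by apply/eqP; rewrite -addr_eq0 ABC.
  by rewrite derivnN (derivn_poly0 sC) oppr0.
have sP : (size P <= (3 * r).+1)%N.
  rewrite (leq_trans (size_polyMleq _ _))// size_exp_XsubC.
  by rewrite addSn ltnS (mulnDl 2 1 r) mul1n leq_add2l.
have P0 : P^`(r) = 0.
  apply/eqP/negPn/negP => P0.
  have := dvdp_leq P0 (p := ('X - a%:P) ^+ r.+1 * ('X - b%:P) ^+ r.+1).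
  rewrite Gauss_dvdp; last first.
    by rewrite coprimep_expl// coprimep_expr// coprimep_XsubC2// subr_eq0 eq_sym.
  rewrite dP/= -[X in _ %| X]opprK dvdpNr -PQ dQ => /(_ isT).
  rewrite size_Mmonic ?monic_exp ?monicXsubC//; last first.
    by rewrite -size_poly_gt0 size_exp_XsubC.
  by rewrite !size_exp_XsubC size_derivn; lia.
(* a nonzero multiple of this power has degree above [r] *)
have eq0 (c : R) (D : {poly R}) :
    (('X - c%:P) ^+ (2 * r).+1 * D)^`(r) = 0 -> D = 0.
  move=> /(congr1 (fun p : {poly R} => size p)).
  rewrite size_derivn size_poly0 => /eqP; rewrite subn_eq0 => sD.
  apply/eqP/negPn/negP => D0; move: sD.
  rewrite size_monicM ?monic_exp ?monicXsubC// size_exp_XsubC.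
  by move: D0; rewrite -size_poly_gt0; lia.
move: ABC; rewrite /P /Q (eq0 a A P0) (eq0 b B) ?mulr0 ?add0r//.
by rewrite -/Q PQ P0 oppr0.
Qed.
End Division.

(** * Smoothness across a point of a line *)

Section Smoothness.
Context {R : realType}.

Lemma near0_gt0 (s : seq (R * R)) : all (fun c => 0 < c.1) s ->
  exists2 dl, 0 < dl &
    forall t : R, `|t| < dl -> all (fun c => 0 < c.1 + t * c.2) s.
Proof.
elim: s => [_|[a b] s IHs /= /andP[a0 /IHs[dl dl0 sdl]]]; first by exists 1.
have b0 : 0 < `|b| + 1 by rewrite ltr_wpDl.
exists (Num.min dl (a / (`|b| + 1))); first by rewrite lt_min dl0 divr_gt0.
move=> t; rewrite lt_min => /andP[/sdl -> /=]; rewrite andbT ltr_pdivlMr// => ta.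
have : `|t * b| < a.
  by rewrite normrM; apply: le_lt_trans ta; rewrite ler_wpM2l// lerDl.
by rewrite ltr_norml => /andP[+ _]; rewrite -subr_gt0 opprK addrC.
Qed.

Lemma dvdXn_deriv (D : {poly R}) n :
  D.[0] = 0 -> 'X^n %| D^`() -> 'X ^+ n.+1 %| D.
Proof.
move=> D0 /dvdpP[u uE]; rewrite -(poly_take_drop n.+1 D) dvdp_addl ?dvdp_mull//.
rewrite [X in _ %| X](_ : _ = 0) ?dvdp0//; apply/polyP => i.
rewrite coef_take_poly coef0; case: ifP => //; case: i => [|i].
  by rewrite -horner_coef0.
rewrite ltnS => iltn; have := coef_deriv D i; rewrite uE coefMXn iltn.
by move=> /esym/eqP; rewrite mulrn_eq0 => /eqP.
Qed.

(** Only one side of [x] is looked at: [F] is meant to be one of the one-sided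
    filters at 0. This makes the derivative of a piecewise polynomial readable
    from either piece, including at the breakpoint. *)
Lemma is_derive_eq_poly (F : set_system R) (FF : ProperFilter F)
    (s : R * R -> R) (x v : R * R) (t d : R) (P : {poly R}) :
  F --> (0 : R)^' -> is_derive x v s d -> s x = P.[t] ->
  (\forall h \near F, s (h *: v + x) = P.[h + t]) -> d = P^`().[t].
Proof.
move=> F0 [ds dE] sx sE.
have [dP dPE] := is_derive_poly P t.
have cs : (fun h => h^-1 *: ((s \o shift x) (h *: v) - s x)) @ F --> d.
  by apply: cvg_trans (cvg_app _ F0) _; rewrite -dE; exact: ds.
have cP : (fun h => h^-1 *: ((horner P \o shift t) (h *: 1) - P.[t])) @ F
    --> P^`().[t].
  by apply: cvg_trans (cvg_app _ F0) _; rewrite -dPE; exact: dP.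
suff : (fun h => h^-1 *: ((s \o shift x) (h *: v) - s x)) @ F --> P^`().[t].
  exact: (cvg_unique _ cs).
apply: cvg_trans cP.
apply: near_eq_cvg; near=> h; rewrite /= sx; congr (_ *: (_ - _)).
rewrite -[LHS](_ : P.[h + t] = _); last by rewrite /GRing.scale/= mulr1.
by near: h; apply: filterS sE => h ->.
Unshelve. all: by end_near. Qed.

(** The derivatives of [s] at [q] along a coordinate axis can be computed from
    either side, so [P] and [Q] have the same ones up to order [k]. In the
    induction the partial derivative along that axis takes the place of [s], with
    the pieces [P'] and [Q']; the existence of two-sided derivatives already
    forces these to agree at 0. Working along an axis avoids having to express a
    general directional derivative through the partial ones. *)
Lemma class_C_dvd (T : set (R * R)) (q e : R * R) (dl : R) (k : nat)
    (s : R * R -> R) (P Q : {poly R}) :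
  0 < dl -> e = (1, 0) \/ e = (0, 1) ->
  (forall t, `|t| < dl -> T^° (t *: e + q)) ->
  (forall t, 0 <= t < dl -> s (t *: e + q) = P.[t]) ->
  (forall t, - dl < t <= 0 -> s (t *: e + q) = Q.[t]) ->
  class_C k T s -> 'X ^+ k.+1 %| P - Q.
Proof.
move=> dl0 eE Tq; elim: k s P Q => [|k IHk] s P Q sP sQ.
  move=> _; rewrite expr1 -['X]subr0 -[X in _ - X]polyC0 dvdp_XsubCl rootE.
  by rewrite hornerD hornerN -sP ?lexx//= -sQ ?lexx ?oppr_lt0 ?dl0// subrr.
move=> [_ [g1 [g2 [dg1 dg2 C1 C2]]]].
have [g [Cg dg]] : exists g, class_C k T g /\
    forall x, T^° x -> is_derive x e s (g x).
  by case: eE => ->; [exists g1|exists g2].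
have dlt t : 0 <= t < dl -> g (t *: e + q) = P^`().[t].
  move=> tdl; apply: (@is_derive_eq_poly (0 : R)^'+ _ s (t *: e + q) e).
  - by apply: within_subset => r /= r0; rewrite gt_eqF.
  - by apply: dg; apply: Tq; rewrite ltr_norml; lra.
  - exact: sP.
  near=> h; rewrite addrA -scalerDl sP//.
  have h0 : 0 < h by near: h; exact: nbhs_right_gt.
  have : h < dl - t by near: h; apply: nbhs_right_lt; lra.
  by lra.
have glt t : - dl < t <= 0 -> g (t *: e + q) = Q^`().[t].
  move=> tdl; apply: (@is_derive_eq_poly (0 : R)^'- _ s (t *: e + q) e).
  - by apply: within_subset => r /= r0; rewrite lt_eqF.
  - by apply: dg; apply: Tq; rewrite ltr_norml; lra.
  - exact: sQ.
  near=> h; rewrite addrA -scalerDl sQ//.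
  have h0 : h < 0 by near: h; exact: nbhs_left_lt.
  have : - dl - t < h by near: h; apply: nbhs_left_gt; lra.
  by lra.
have := IHk _ _ _ dlt glt Cg; rewrite -derivB => dvdPQ.
have PQ0 : (P - Q).[0] = 0.
  by rewrite hornerD hornerN -sP ?lexx//= -sQ ?lexx ?oppr_lt0 ?dl0// subrr.
exact: dvdXn_deriv.
Unshelve. all: by end_near. Qed.
End Smoothness.

(** * Area-preserving affine maps *)

Section AreaPreservation.
Context {R : realType}.
Local Notation mR := (measurableTypeR R).
Local Notation plane := (measurableTypeR R * measurableTypeR R)%type.

Lemma lebesgue_measure_isometry (e k : R) (A : set mR) :
  e = 1 \/ e = -1 -> measurable A ->
  lebesgue_measure ((fun y : mR => e * y + k : mR) @^-1` A) = lebesgue_measure A.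
Proof.
move=> eE mA; have mf : measurable_fun [set: mR] (fun y : mR => e * y + k : mR).
  by apply: measurable_funD => //; apply: measurable_funM.
rewrite -[LHS]/(pushforward lebesgue_measure (fun y : mR => e * y + k : mR) A).
apply/esym/lebesgue_measure_unique => //= _ [[a b] /= ab <-].
rewrite /pushforward; case: eE => ->.
  rewrite [X in _ = lebesgue_measure X](_ : _ = `]a - k, b - k]%classic).
    rewrite !lebesgue_measure_itv/= !lte_fin ltrD2r -!EFinD.
    by congr (if _ then _%:E else _); ring.
  by apply/seteqP; split => y /=; rewrite !in_itv/=; lra.
rewrite [X in _ = lebesgue_measure X](_ : _ = `[k - b, k - a[%classic).
  rewrite !lebesgue_measure_itv/= !lte_fin ltrD2l ltrN2 -!EFinD.
  by congr (if _ then _%:E else _); ring.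
by apply/seteqP; split => y /=; rewrite !in_itv/=; lra.
Qed.

Definition area_preserving (S : plane -> plane) :=
  measurable_fun [set: plane] S /\
  forall A, measurable A -> mu2 (S @^-1` A) = mu2 A.

Lemma area_preserving_comp S S' :
  area_preserving S -> area_preserving S' -> area_preserving (S \o S').
Proof.
move=> [mS SE] [mS' SE']; split; first exact: measurableT_comp.
move=> A mA; rewrite comp_preimage SE' ?SE// -[X in measurable X]setTI.
exact: mS.
Qed.

Lemma measurable_affine (a b c : R) :
  measurable_fun [set: plane] (fun x : plane => a * x.1 + b * x.2 + c : mR).
Proof.
by apply: measurable_funD => //; apply: measurable_funD; apply: measurable_funM.
Qed.

(** On each vertical line the map is an isometry. *)
Lemma area_preserving_vertical (e a c : R) : e = 1 \/ e = -1 ->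
  area_preserving (fun x => (x.1, a * x.1 + e * x.2 + c)).
Proof.
move=> eE; set S : plane -> plane := fun _ => _.
have mS : measurable_fun [set: plane] S.
  by apply: measurable_fun_pair => //; exact: measurable_affine.
split=> // A mA; rewrite /mu2 /product_measure1.
apply: eq_integral => x _ /=.
rewrite -[RHS](@lebesgue_measure_isometry e (a * x + c)) //; last first.
  exact: measurable_xsection.
congr (lebesgue_measure _); apply/seteqP; split => y /=;
  by rewrite /xsection/= !inE/S/= [a * x + e * y]addrC addrA.
Qed.

(** Measuring sections in the other order is Tonelli's theorem. *)
Lemma area_ysection (A : set plane) : measurable A ->
  mu2 A = (\int[@lebesgue_measure R]_y lebesgue_measure (ysection A y))%E.
Proof.
apply: (@product_measure_unique _ _ _ _ _ (@lebesgue_measure R)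
  (@lebesgue_measure R) (@lebesgue_measure R \x^ @lebesgue_measure R)%E).
by move=> B C mB mC /=; rewrite product_measure2E.
Qed.

Lemma area_preserving_horizontal (e b c : R) : e = 1 \/ e = -1 ->
  area_preserving (fun x => (e * x.1 + b * x.2 + c, x.2)).
Proof.
move=> eE; set S : plane -> plane := fun _ => _.
have mS : measurable_fun [set: plane] S.
  by apply: measurable_fun_pair => //; exact: measurable_affine.
split=> // A mA; rewrite !area_ysection//; last first.
  by rewrite -[X in measurable X]setTI; exact: mS.
apply: eq_integral => y _ /=.
rewrite -[RHS](@lebesgue_measure_isometry e (b * y + c)) //; last first.
  exact: measurable_ysection.
congr (lebesgue_measure _); apply/seteqP; split => x /=;
  by rewrite /ysection/= !inE/S/= addrA.
Qed.

(** The affine form [psi(x) = a x.1 + b x.2 + c] decreases by 2 along [d], so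
    [x + psi(x) d] is an oblique reflection in the direction [d]. If [d] is
    vertical it preserves every vertical line. Otherwise a vertical shear makes [d]
    horizontal, and conjugating the reflection by this shear gives a map that
    preserves every horizontal line. *)
Lemma area_preserving_reflection (a b c : R) (d : R * R) :
  a * d.1 + b * d.2 = -2 ->
  area_preserving (fun x => x + (a * x.1 + b * x.2 + c) *: d).
Proof.
case: d => d1 d2 /= ad; have [d10|d10] := eqVneq d1 0.
  have := @area_preserving_vertical (-1) (a * d2) (c * d2) (or_intror erefl).
  congr area_preserving; apply/funext => -[x y]; congr pair; rewrite /GRing.scale/=.
    by rewrite d10; ring.
  have -> : -1 = 1 + b * d2 by rewrite d10 in ad; lra.
  by rewrite /GRing.scale/=; ring.
have [m d2E] : exists m, d2 = m * d1 by exists (d2 / d1); rewrite divfK.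
subst d2.
have H1 := @area_preserving_vertical 1 (- m) 0 (or_introl erefl).
have H2 := @area_preserving_horizontal (-1) (b * d1) (c * d1) (or_intror erefl).
have H3 := @area_preserving_vertical 1 m 0 (or_introl erefl).
have := area_preserving_comp H3 (area_preserving_comp H2 H1).
congr area_preserving; apply/funext => -[x y]; rewrite /GRing.scale/=.
have bE : -1 = 1 + a * d1 + b * m * d1 by rewrite -mulrA; lra.
congr pair.
  by rewrite bE /GRing.scale/= /GRing.scale/=; ring.
by rewrite bE /GRing.scale/= /GRing.scale/=; ring.
Qed.
End AreaPreservation.

(** * Barycentric coordinates and permutations of the vertices *)

Lemma sum_ord3 (V : zmodType) (F : 'I_3 -> V) :
  \sum_i F i = F ord0 + F (lift ord0 ord0) + F (lift ord0 (lift ord0 ord0)).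
Proof. by rewrite !big_ord_recl big_ord0 addr0 addrA. Qed.

Lemma third_index (i j : 'I_3) : i != j ->
  exists k, [/\ k != i, k != j & forall m, m \in [:: i; j; k]].
Proof.
by case: i j => -[|[|[|//]]] ? -[[|[|[|//]]] ?]// _;
  [exists (@Ordinal 3 2 isT)|exists (@Ordinal 3 1 isT)|exists (@Ordinal 3 2 isT)
  |exists (@Ordinal 3 0 isT)|exists (@Ordinal 3 1 isT)|exists (@Ordinal 3 0 isT)];
  split => // -[[|[|[|//]]] ?].
Qed.

Section Barycentric.
Context {R : realType}.
Implicit Types (x u v : R * R).

Definition cross u v : R := u.1 * v.2 - u.2 * v.1.

Lemma nondegenerate_cross (p1 p2 p3 : R * R) :
  nondegenerate_triangle p1 p2 p3 -> cross (p2 - p1) (p3 - p1) != 0.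
Proof.
rewrite /nondegenerate_triangle; set u := p2 - p1; set v := p3 - p1.
move=> /freeP uv; apply/negP => /eqP uv0.
have H (a b : R) : a *: u + b *: v = 0 -> a = 0 /\ b = 0.
  move=> ab0; have := uv (fun i => [:: a; b]`_i).
  rewrite !big_ord_recl big_ord0 /= addr0 => /(_ ab0) k0.
  by split; [exact: (k0 ord0)|exact: (k0 (lift ord0 ord0))].
have [] := H v.1 (- u.1).
  rewrite scaleNr; apply/pair_equal_spec; split; last first.
    by rewrite -[LHS]/(v.1 * u.2 - u.1 * v.2) -[RHS]oppr0 -uv0 /cross opprB mulrC.
  by rewrite -[LHS]/(v.1 * u.1 - u.1 * v.1) mulrC subrr.
have [] := H v.2 (- u.2).
  rewrite scaleNr; apply/pair_equal_spec; split.
    by rewrite -[LHS]/(v.2 * u.1 - u.2 * v.1) -[RHS]uv0 /cross mulrC.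
  by rewrite -[LHS]/(v.2 * u.2 - u.2 * v.2) mulrC subrr.
move=> v20 /eqP; rewrite oppr_eq0 => /eqP u20 v10 /eqP; rewrite oppr_eq0 => /eqP u10.
have [] := H 1 0; last by move=> /eqP; rewrite oner_eq0.
by rewrite scale0r addr0 scale1r; apply/pair_equal_spec.
Qed.

Context (p1 p2 p3 : R * R).

Definition vertex (i : 'I_3) : R * R := [:: p1; p2; p3]`_i.

(** Ratios of signed areas: the triangle with vertex [i] replaced by [x], over
    the whole triangle. *)
Definition bcoord (i : 'I_3) (x : R * R) : R :=
  [:: cross (p2 - x) (p3 - x); cross (p3 - x) (p1 - x);
      cross (p1 - x) (p2 - x)]`_i / cross (p2 - p1) (p3 - p1).

Lemma Pd_bcoord i : Pd 1 (bcoord i).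
Proof.
have H u v : Pd 1 (fun x => cross (u - x) (v - x) / cross (p2 - p1) (p3 - p1)).
  set D := _^-1.
  have := Pd1_affine ((u.2 - v.2) * D) ((v.1 - u.1) * D) (cross u v * D).
  congr Pd; apply/funext => x; rewrite /cross/=; ring.
by case: i => -[|[|[|//]]] ?; exact: H.
Qed.

Lemma baryE a : bary p1 p2 p3 a = \sum_(i < 3) a`_i *: vertex i.
Proof. by rewrite sum_ord3. Qed.

Context (hT : nondegenerate_triangle p1 p2 p3).

Lemma sum_bcoord x : \sum_i bcoord i x = 1.
Proof.
have := nondegenerate_cross hT; rewrite sum_ord3 /bcoord /= /cross /= => D0.
by field.
Qed.

Lemma bcoordK x : \sum_i bcoord i x *: vertex i = x.
Proof.
have := nondegenerate_cross hT; rewrite sum_ord3 /bcoord /vertex /= /cross /= => D0.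
case: x => x y; apply/pair_equal_spec; rewrite /= /GRing.scale/=.
by split; field.
Qed.

Lemma bcoord_sum (a : 'I_3 -> R) i :
  \sum_j a j = 1 -> bcoord i (\sum_j a j *: vertex j) = a i.
Proof.
have := nondegenerate_cross hT; rewrite !sum_ord3 /bcoord /vertex /= /cross /= => D0.
set i2 := lift _ (lift _ _); set i1 := lift _ _; set i0 := ord0 => sa.
have -> : a i = [:: a i0; a i1; a i2]`_i.
  by case: i => -[|[|[|//]]] ?; congr a; exact: val_inj.
have -> : a i0 = 1 - a i1 - a i2 by rewrite -sa; ring.
by case: i => -[|[|[|//]]] ? /=; rewrite /GRing.scale/=; field.
Qed.

Lemma triangleE x : triangle p1 p2 p3 x <-> forall i, 0 <= bcoord i x.
Proof.
split.
  move=> [a1 [a2 [a3 [a10 a20 a30 sa ->]]]] i.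
  rewrite baryE bcoord_sum; last by rewrite sum_ord3.
  by case: i => -[|[|[|//]]].
move=> x0; exists (bcoord ord0 x), (bcoord (lift ord0 ord0) x),
  (bcoord (lift ord0 (lift ord0 ord0)) x); split => //.
- by have := sum_bcoord x; rewrite sum_ord3.
- by rewrite -[LHS]bcoordK sum_ord3.
Qed.

Implicit Types (s : 'S_3).

Definition vertex_map (s : 'S_3) (x : R * R) : R * R :=
  \sum_i bcoord i x *: vertex (s i).

Lemma affine_vertex_map s : affine_map (vertex_map s).
Proof.
split.
  have := @Pd_sum R 1 _ (index_enum 'I_3) xpredT
    (fun i x => (vertex (s i)).1 * bcoord i x) (fun i _ => PdZ _ (Pd_bcoord i)).
  congr Pd; apply/funext => x; rewrite /vertex_map !sum_ord3/= /GRing.scale/=.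
  by rewrite ![_ * bcoord _ _]mulrC.
have := @Pd_sum R 1 _ (index_enum 'I_3) xpredT
  (fun i x => (vertex (s i)).2 * bcoord i x) (fun i _ => PdZ _ (Pd_bcoord i)).
congr Pd; apply/funext => x; rewrite /vertex_map !sum_ord3/= /GRing.scale/=.
by rewrite ![_ * bcoord _ _]mulrC.
Qed.

Lemma bcoord_vertex_map s i x : bcoord (s i) (vertex_map s x) = bcoord i x.
Proof.
have sE : vertex_map s x = \sum_j bcoord (s^-1%g j) x *: vertex j.
  rewrite /vertex_map [RHS](reindex_inj (@perm_inj _ s))/=.
  by apply: eq_bigr => j _; rewrite permK.
rewrite sE bcoord_sum ?permK// -[RHS](sum_bcoord x).
by rewrite [RHS](reindex_inj (@perm_inj _ s^-1%g)).
Qed.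

Lemma vertex_mapM s t x :
  vertex_map s (vertex_map t x) = vertex_map (t * s)%g x.
Proof.
rewrite {1}/vertex_map (reindex_inj (@perm_inj _ t))/=.
by apply: eq_bigr => i _; rewrite bcoord_vertex_map permM.
Qed.

Lemma vertex_map1 x : vertex_map 1%g x = x.
Proof.
by rewrite -[RHS]bcoordK; apply: eq_bigr => i _; rewrite perm1.
Qed.

(** A transposition of two vertices acts as an oblique reflection, which is how
    it is seen to preserve area. *)
Lemma vertex_map_tperm i j x : i != j -> vertex_map (tperm i j) x =
  x + (bcoord i x - bcoord j x) *: (vertex j - vertex i).
Proof.
move=> ij; rewrite -[X in X + _]bcoordK /vertex_map.
rewrite (bigD1 i)//= [in RHS](bigD1 i)//= tpermL.
rewrite (bigD1 j) 1?eq_sym//= [in RHS](bigD1 j) 1?eq_sym//= tpermR.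
rewrite (eq_bigr (fun k => bcoord k x *: vertex k)); last first.
  by move=> k /andP[ki kj]; rewrite tpermD// eq_sym.
move: (\sum_(k | _) _) (vertex i) (vertex j) => [c c'] [a b] [a' b'].
apply/pair_equal_spec; rewrite /= /GRing.scale/= /GRing.scale/=.
by split; ring.
Qed.

Lemma triangle_vertex_map s x :
  triangle p1 p2 p3 (vertex_map s x) <-> triangle p1 p2 p3 x.
Proof.
rewrite !triangleE; split => x0 i.
  by rewrite -(bcoord_vertex_map s).
by rewrite -(permKV s i) bcoord_vertex_map.
Qed.

Lemma bcoord_vertex i j : bcoord i (vertex j) = (i == j)%:R.
Proof.
have -> : vertex j = \sum_k (k == j)%:R *: vertex k.
  rewrite (bigD1 j)//= eqxx scale1r big1 ?addr0// => k /negPf ->.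
  by rewrite scale0r.
rewrite bcoord_sum// (bigD1 j)//= eqxx big1 ?addr0// => k /negPf ->//.
Qed.

Lemma area_preserving_vertex_map s : area_preserving (vertex_map s).
Proof.
have [ts -> _] := prod_tpermP s; elim: ts => [|[i j] ts IHts].
  rewrite big_nil; split => [|A mA].
    by rewrite (_ : vertex_map _ = id)//; apply/funext => x; rewrite vertex_map1.
  by congr mu2; apply/seteqP; split => x /=; rewrite vertex_map1.
rewrite big_cons/=; have [->|ij] := eqVneq i j; first by rewrite tperm1 mul1g.
have -> : vertex_map (tperm i j * \prod_(t <- ts) tperm t.1 t.2)%g =
    vertex_map (\prod_(t <- ts) tperm t.1 t.2)%g \o vertex_map (tperm i j).
  by apply/funext => x; rewrite /= vertex_mapM.
apply: (area_preserving_comp IHts).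
have [a [b [c lE]]] := Pd1E (PdB (Pd_bcoord i) (Pd_bcoord j)).
have lEx x : bcoord i x - bcoord j x = a * x.1 + b * x.2 + c.
  exact: (congr1 (fun f => f x) lE).
have := @area_preserving_reflection R a b c (vertex j - vertex i).
have -> : vertex_map (tperm i j) = fun x => x + (a * x.1 + b * x.2 + c) *:
    (vertex j - vertex i).
  by apply/funext => x; rewrite vertex_map_tperm// lEx.
apply; transitivity ((bcoord i (vertex j) - bcoord j (vertex j))
    - (bcoord i (vertex i) - bcoord j (vertex i))).
  by rewrite !lEx/=; ring.
have ji : j != i by rewrite eq_sym.
by rewrite !bcoord_vertex !eqxx (negPf ij) (negPf ji)/=; ring.
Qed.

(** * Invariance of symmetric rules *)

Definition permute (s : 'S_3) (a : seq R) : seq R :=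
  [seq a`_(s i) | i : 'I_3].

Lemma permute_perm_eq s a : size a = 3%N -> perm_eq (permute s a) a.
Proof.
move=> sa.
have -> : permute s a = [seq a`_(i : 'I_3) | i <- [seq s i | i <- enum 'I_3]].
  by rewrite -map_comp.
have aE : a = [seq a`_(i : 'I_3) | i <- enum 'I_3].
  by rewrite -[LHS](mkseq_nth 0) sa /mkseq -val_enum_ord -map_comp.
rewrite [X in perm_eq _ X]aE; apply: perm_map; apply: uniq_perm.
  by rewrite map_inj_uniq ?enum_uniq//; exact: perm_inj.
  exact: enum_uniq.
by move=> i; rewrite -[i](permKV s) mem_map ?mem_enum//; exact: perm_inj.
Qed.

Lemma nth_permute s a (i : 'I_3) : (permute s a)`_i = a`_(s i).
Proof.
by rewrite /permute (nth_map i) ?size_enum_ord// nth_ord_enum.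
Qed.

Lemma permuteM s t a : permute s (permute t a) = permute (s * t)%g a.
Proof. by apply: eq_map => i; rewrite nth_permute permM. Qed.

Lemma perm_eq_permutations s b : size b = 3%N ->
  perm_eq [seq permute s a | a <- permutations b] (permutations b).
Proof.
move=> sb.
have size3 a : a \in permutations b -> size a = 3%N.
  by rewrite mem_permutations => /perm_size ->.
have permute1 a : size a = 3%N -> permute 1%g a = a.
  move=> sa; apply: (@eq_from_nth _ 0); first by rewrite size_map size_enum_ord sa.
  move=> i; rewrite size_map size_enum_ord => i3.
  by rewrite (nth_permute _ _ (Ordinal i3)) perm1.
have inP t a : a \in permutations b -> permute t a \in permutations b.
  move=> ab; rewrite mem_permutations (perm_trans (permute_perm_eq _ (size3 _ ab)))//.
  by rewrite -mem_permutations.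
apply: uniq_perm; rewrite ?permutations_uniq//.
  rewrite map_inj_in_uniq ?permutations_uniq// => a a' /size3 sa /size3 sa'.
  by move=> /(congr1 (permute s^-1%g)); rewrite !permuteM !mulVg !permute1.
move=> a; apply/mapP/idP => [[a' a'b ->]|ab]; first exact: inP.
exists (permute s^-1%g a); first exact: inP.
by rewrite permuteM mulgV permute1// size3.
Qed.

Lemma vertex_map_bary s a : size a = 3%N -> \sum_(c <- a) c = 1 ->
  vertex_map s (bary p1 p2 p3 a) = bary p1 p2 p3 (permute s^-1%g a).
Proof.
move=> sa a1; rewrite !baryE /vertex_map [RHS](reindex_inj (@perm_inj _ s))/=.
apply: eq_bigr => i _; rewrite nth_permute permK bcoord_sum//.
by rewrite -[RHS]a1 [RHS](big_nth 0) sa big_mkord.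
Qed.

(** Moving a node by a vertex map permutes its barycentric triple, hence
    permutes the orbit. *)
Lemma orbit_sum_vertex_map s b f : size b = 3%N -> \sum_(c <- b) c = 1 ->
  orbit_sum p1 p2 p3 b (f \o vertex_map s) = orbit_sum p1 p2 p3 b f.
Proof.
move=> sb b1; rewrite /orbit_sum -[RHS](perm_big _ (perm_eq_permutations s^-1 sb)).
rewrite [RHS]big_map !big_seq; apply: eq_bigr => a; rewrite mem_permutations => ab.
by rewrite /= vertex_map_bary// ?(perm_size ab)// (perm_big _ ab).
Qed.

Section Rule.
Context (n0 n1 n2 : nat) (Q : (R * R -> R) -> R).
Context (hQ : symmetric_rule p1 p2 p3 n0 n1 n2 Q).
Local Notation T := (triangle p1 p2 p3).

Lemma sum_type1 (a : R) : \sum_(c <- type1 a) c = 1.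
Proof. by rewrite !big_cons big_nil; ring. Qed.

Lemma sum_type2 (a b : R) : \sum_(c <- type2 a b) c = 1.
Proof. by rewrite !big_cons big_nil; ring. Qed.

Lemma rule_vertex_map s f : Q (f \o vertex_map s) = Q f.
Proof.
have [_ [w0 [w1 [t1 [w2 [t2 [e2 [_ _ QE]]]]]]]] := hQ.
rewrite !QE; congr (_ * (_ + _ + _)).
- case: ifP => // _; congr (_ * f _) => /=.
  rewrite !baryE /vertex_map (reindex_inj (@perm_inj _ s^-1%g))/=.
  apply: eq_bigr => i _; rewrite permKV bcoord_sum.
    by case: i => -[|[|[|//]]] ?; case: (s^-1%g _) => -[|[|[|//]]] ?.
  by rewrite sum_ord3/=; field.
- apply: eq_bigr => i _; rewrite orbit_sum_vertex_map//; exact: sum_type1.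
- apply: eq_bigr => i _; rewrite orbit_sum_vertex_map//; exact: sum_type2.
Qed.

Lemma rule_eq_on f g : (forall x, T x -> f x = g x) -> Q f = Q g.
Proof.
have [_ [w0 [w1 [t1 [w2 [t2 [e2 [h1 h2 QE]]]]]]]] := hQ => fg.
rewrite !QE; congr (_ * (_ + _ + _)).
- case: ifP => // _; rewrite fg//; exists 3^-1, 3^-1, 3^-1.
  by split; rewrite ?invr_ge0 ?ler0n//; field.
- apply: eq_bigr => i _; congr (_ * _); rewrite /orbit_sum !big_seq.
  by apply: eq_bigr => a ab; apply: fg; exact: (h1 i).2.
- apply: eq_bigr => i _; congr (_ * _); rewrite /orbit_sum !big_seq.
  by apply: eq_bigr => a ab; apply: fg; exact: (h2 i).2.
Qed.

Lemma rule_sum (I : finType) (F : I -> R * R -> R) :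
  Q (fun x => \sum_i F i x) = \sum_i Q (F i).
Proof.
have [_ [w0 [w1 [t1 [w2 [t2 [e2 [_ _ QE]]]]]]]] := hQ.
rewrite QE [RHS](eq_bigr _ (fun i _ => QE (F i))) -mulr_sumr !big_split/=.
congr (_ * (_ + _ + _)).
- by case: ifP => _; [rewrite big1|rewrite mulr_sumr].
- rewrite [RHS]exchange_big/=; apply: eq_bigr => i _.
  by rewrite -mulr_sumr /orbit_sum [in LHS]exchange_big.
- rewrite [RHS]exchange_big/=; apply: eq_bigr => i _.
  by rewrite -mulr_sumr /orbit_sum [in LHS]exchange_big.
Qed.
End Rule.

(** * Divisibility of the differences of pieces *)

Local Notation T := (triangle p1 p2 p3).

Lemma bcoord_line i x u v (t : R) :
  bcoord i (x + t *: (u - v)) = bcoord i x + t * (bcoord i u - bcoord i v).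
Proof.
have [a [b [c ->]]] := Pd1E (Pd_bcoord i).
by case: x u v => x1 x2 [u1 u2] [v1 v2]; rewrite /= /GRing.scale/=; ring.
Qed.

Lemma bcoord_inj x y : (forall i, bcoord i x = bcoord i y) -> x = y.
Proof.
move=> xy; rewrite -[x]bcoordK -[y]bcoordK.
by apply: eq_bigr => i _; rewrite xy.
Qed.

Lemma interior_triangle x : (forall i, 0 < bcoord i x) -> T^° x.
Proof.
move=> x0; have cont i : {for x, continuous (bcoord i)}.
  have [a [b [c ->]]] := Pd1E (Pd_bcoord i).
  have c1 : {for x, continuous (fun x : R * R => x.1)} by exact: cvg_fst.
  have c2 : {for x, continuous (fun x : R * R => x.2)} by exact: cvg_snd.
  have cM k (h : R * R -> R) : {for x, continuous h} ->
    {for x, continuous (fun x => k * h x)} by move=> ch; exact: cvgMr.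
  have := continuousD (continuousD (cM a _ c1) (cM b _ c2)) (@cst_continuous _ _ c x).
  exact.
have near_gt0 i : \forall y \near x, 0 < bcoord i y.
  by apply: (cvgr_gt (bcoord i x) (cont i)).
have : \forall y \near x, forall i, 0 < bcoord i y by
  exact: (@filter_forall _ _ (fun i y => 0 < bcoord i y) (nbhs x) _ near_gt0).
by apply: filterS => y y0; rewrite triangleE => i; exact/ltW.
Qed.

(** The subtriangles are indexed by the opposite vertex: the one numbered [k] is
    the part of the triangle where [bcoord k] is minimal. *)
Lemma spline_pieces rho d f :
  spline_space rho d T (CT_split p1 p2 p3) f ->
  class_C rho T f /\ exists g : 'I_3 -> R * R -> R,
    (forall k, Pd d (g k)) /\
    forall k x, (forall i, 0 <= bcoord k x <= bcoord i x) -> f x = g k x.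
Proof.
move=> [Cf fp]; split => //.
have [g2 P2 E2] := fp _ (or_introl (or_introl erefl)).
have [g0 P0 E0] := fp _ (or_introl (or_intror erefl)).
have [g1 P1 E1] := fp _ (or_intror erefl).
exists (fun k => nth g0 [:: g0; g1; g2] k).
split; first by case=> -[|[|[|//]]].
pose i0 : 'I_3 := ord0; pose i1 : 'I_3 := lift ord0 ord0.
pose i2 : 'I_3 := lift ord0 (lift ord0 ord0).
have xE x : x = bcoord i0 x *: p1 + bcoord i1 x *: p2 + bcoord i2 x *: p3.
  by rewrite -[LHS]bcoordK sum_ord3.
have x1 x : bcoord i0 x + bcoord i1 x + bcoord i2 x = 1.
  by rewrite -(sum_bcoord x) sum_ord3.
have baryE' (a b c : R) (q1 q2 q3 : R * R) : bary q1 q2 q3 [:: a; b; c] =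
    (a * q1.1 + b * q2.1 + c * q3.1, a * q1.2 + b * q2.2 + c * q3.2) by [].
move=> k x kx; have := (kx i0, kx i1, kx i2); move: (xE x) (x1 x).
set b0 := bcoord i0 x; set b1 := bcoord i1 x; set b2 := bcoord i2 x => xb sb.
have {}xb : x = (b0 * p1.1 + b1 * p2.1 + b2 * p3.1,
  b0 * p1.2 + b1 * p2.2 + b2 * p3.2) by rewrite xb.
have three : (3 : R) != 0 by [].
have [->|->|->] : [\/ k = i0, k = i1 | k = i2].
  by case: k {kx} => -[|[|[|//]]] ?; [constructor 1|constructor 2|constructor 3];
    exact: val_inj.
- rewrite -/b0 => -[[/andP[h1 h2] /andP[h3 h4]] /andP[h5 h6]].
  apply: E0; exists (b1 - b0), (b2 - b0), (3 * b0).
  split; [lra|lra|lra|lra|rewrite {1}xb baryE' /barycenter/= /GRing.scale/=].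
  by congr pair; field.
- rewrite -/b1 => -[[/andP[h1 h2] /andP[h3 h4]] /andP[h5 h6]].
  apply: E1; exists (b2 - b1), (b0 - b1), (3 * b1).
  split; [lra|lra|lra|lra|rewrite {1}xb baryE' /barycenter/= /GRing.scale/=].
  by congr pair; field.
- rewrite -/b2 => -[[/andP[h1 h2] /andP[h3 h4]] /andP[h5 h6]].
  apply: E2; exists (b0 - b2), (b1 - b2), (3 * b2).
  split; [lra|lra|lra|lra|rewrite {1}xb baryE' /barycenter/= /GRing.scale/=].
  by congr pair; field.
Qed.

(** [bcoord i - bcoord j] is not constant, so one of the coordinate axes is
    transversal to its zero line. *)
Lemma transversal_axis (i j : 'I_3) : i != j -> exists (e : R * R) (kappa : 'I_3 -> R),
  [/\ e = (1, 0) \/ e = (0, 1), kappa i != kappa j &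
    forall m q t, bcoord m (q + t *: e) = bcoord m q + t * kappa m].
Proof.
move=> ij.
have [a [b [c lE]]] := Pd1E (PdB (Pd_bcoord i) (Pd_bcoord j)).
have {}lE x : bcoord i x - bcoord j x = a * x.1 + b * x.2 + c :=
  congr1 (fun f => f x) lE.
have line e m q (t : R) : bcoord m (q + t *: e) =
    bcoord m q + t * (bcoord m e - bcoord m (0, 0)).
  by rewrite -bcoord_line -[(0, 0)]/(0 : R * R) subr0.
have := lE (0, 0); have [a0|a0] := eqVneq a 0; last first.
  have := lE (1, 0); rewrite /= => e1 e0.
  exists (1, 0), (fun m => bcoord m (1, 0) - bcoord m (0, 0)).
  split => //; first by left.
  by apply/eqP => ke; move/eqP: a0; apply; lra.
have [b0|b0] := eqVneq b 0; last first.
  have := lE (0, 1); rewrite /= => e1 e0.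
  exists (0, 1), (fun m => bcoord m (0, 1) - bcoord m (0, 0)).
  split => //; first by right.
  by apply/eqP => ke; move/eqP: b0; apply; lra.
have ji : j != i by rewrite eq_sym.
have := (lE (vertex i), lE (vertex j)).
rewrite a0 b0 !bcoord_vertex !eqxx (negPf ij) (negPf ji)/= => -[h1 h2] _.
by exfalso; lra.
Qed.

(** One factor is extracted at a time. After [n <= k] factors the cofactor [e]
    must vanish on the line [bcoord i = bcoord j]: at a point of the open
    interior edge, restricting to a transversal axis and comparing with
    [class_C_dvd] shows that [e] vanishes there, and a polynomial vanishing on a
    segment vanishes on its line. *)
Lemma smooth_division (f : R * R -> R) (g : 'I_3 -> R * R -> R) (k d : nat)
    (i j : 'I_3) : i != j -> (k < d)%N -> (forall m, Pd d (g m)) ->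
  class_C k T f ->
  (forall m x, (forall n, 0 <= bcoord m x <= bcoord n x) -> f x = g m x) ->
  exists2 e, Pd (d - k.+1) e &
    forall x, g i x - g j x = (bcoord i x - bcoord j x) ^+ k.+1 * e x.
Proof.
move=> ij kd Pg Cf fg; pose l x := bcoord i x - bcoord j x.
have Pl : Pd 1 l by apply: PdB; exact: Pd_bcoord.
have [h [hi hj ijo]] := third_index ij.
have [v [kappa [vE kij vL]]] := transversal_axis ij.
(* the interior edge runs from the barycenter [c] to the third vertex [h] *)
pose c : R * R := \sum_m 3^-1 *: vertex m.
have cE m : bcoord m c = 3^-1 by rewrite bcoord_sum// sum_ord3; field.
suff H : forall n, (n <= k.+1)%N -> exists2 e, Pd (d - n) e &
    forall x, g i x - g j x = l x ^+ n * e x by exact: (H k.+1).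
elim=> [_|n IHn nk].
  exists (fun x => g i x - g j x); first by rewrite subn0; exact: PdB.
  by move=> x; rewrite mul1r.
have [e Pe eE] := IHn (ltnW nk).
suff e0 : forall x, l x = 0 -> e x = 0.
  have [g' Pg' gE'] : exists2 g', Pd (d - n.+1) g' & forall x, e x = l x * g' x.
    apply: (@Pd_div R (d - n.+1) e l (2^-1 *: (vertex i - vertex j))) => //.
      move=> x; rewrite scalerA -scaleNr /l !bcoord_line !bcoord_vertex.
      have ji : j != i by rewrite eq_sym.
      by rewrite !eqxx (negPf ij) (negPf ji)/=; field.
    by rewrite -subSn ?(leq_trans nk)// subSS.
  by exists g' => // x; rewrite eE gE' exprSr mulrA.
have edge q : 0 < bcoord i q -> l q = 0 -> bcoord i q < bcoord h q -> e q = 0.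
  move=> q0 lq qo.
  have qij : bcoord j q = bcoord i q by move: lq; rewrite /l; lra.
  have [P _ PE] := Pd_line q v (Pg i).
  have [Q _ QE] := Pd_line q v (Pg j).
  have [E _ EE] := Pd_line q v Pe.
  (* near [q] the axis stays in the open triangle, away from the third piece *)
  have [|dl dl0 dlP] := @near0_gt0 _ [:: (bcoord i q, kappa i); (bcoord j q, kappa j);
      (bcoord h q, kappa h); (bcoord h q - bcoord i q, kappa h - kappa i);
      (bcoord h q - bcoord j q, kappa h - kappa j)].
    by rewrite /= qij q0 (lt_trans q0 qo) subr_gt0 qo.
  have pos t m : `|t| < dl -> 0 < bcoord m (t *: v + q).
    move=> /dlP/= /and5P[h1 h2 h3 _ _]; rewrite addrC vL.
    by have := ijo m; rewrite !inE => /or3P[] /eqP ->.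
  have fi t : `|t| < dl -> t * (kappa i - kappa j) <= 0 -> f (t *: v + q) = P.[t].
    move=> tdl tk; rewrite -PE addrC; apply: fg => m; rewrite addrC ltW ?pos//= addrC.
    have /and5P[_ _ _ h4 h5] := dlP _ tdl; move: h4 h5 => /= h4 /andP[h5 _].
    by have := ijo m; rewrite !inE => /or3P[] /eqP ->; rewrite !vL; lra.
  have fj t : `|t| < dl -> 0 <= t * (kappa i - kappa j) -> f (t *: v + q) = Q.[t].
    move=> tdl tk; rewrite -QE addrC; apply: fg => m; rewrite addrC ltW ?pos//= addrC.
    have /and5P[_ _ _ h4 h5] := dlP _ tdl; move: h4 h5 => /= h4 /andP[h5 _].
    by have := ijo m; rewrite !inE => /or3P[] /eqP ->; rewrite !vL; lra.
  have PQ : 'X ^+ k.+1 %| P - Q.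
    have Tv t : `|t| < dl -> T^° (t *: v + q).
      by move=> tdl; apply: interior_triangle => m; exact: pos.
    have [kpos|kneg] : 0 < kappa i - kappa j \/ kappa i - kappa j < 0.
      by move: kij; rewrite -subr_eq0 neq_lt => /orP[]; [right|left].
    - rewrite -dvdpNr opprB; apply: (class_C_dvd dl0 vE Tv _ _ Cf) => t /andP[t1 t2].
        by apply: fj; [rewrite ger0_norm|rewrite mulr_ge0// ltW].
      apply: fi; first by rewrite ler0_norm// ltrNl.
      by rewrite mulr_le0_ge0// ltW.
    - apply: (class_C_dvd dl0 vE Tv _ _ Cf) => t /andP[t1 t2].
        by apply: fi; [rewrite ger0_norm|rewrite mulr_ge0_le0// ltW].
      apply: fj; first by rewrite ler0_norm// ltrNl.
      by rewrite mulr_le0// ltW.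
  have PQE : P - Q = ((kappa i - kappa j)%:P * 'X) ^+ n * E.
    apply/eqP; rewrite -subr_eq0; apply/eqP/poly_eq0_itv => t _.
    rewrite !hornerE -PE -QE -EE eE /l !vL qij.
    by apply/eqP; rewrite subr_eq0; apply/eqP; congr (_ ^+ _ * _); ring.
  move: PQ; rewrite PQE exprMn -rmorphXn/= -mulrA mul_polyC dvdpZr; last first.
    by rewrite expf_neq0// subr_eq0.
  rewrite -(subnKC nk) addSnnS exprD dvdp_mul2l ?expf_neq0 ?polyX_eq0// exprS.
  move=> /dvdpP[u uE].
  have -> : q = q + 0 *: v by rewrite scale0r addr0.
  by rewrite EE uE !hornerE/= mulr0 mul0r.
move=> x lx.
have s1 y : bcoord i y + bcoord j y + bcoord h y = 1.
  rewrite -(sum_bcoord y) (bigD1 i)//= (bigD1 j) 1?eq_sym//= (bigD1 h)/=; last first.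
    by rewrite hi hj.
  rewrite big1 ?addr0 ?addrA// => m /andP[/andP[mi mj] mh].
  by have := ijo m; rewrite !inE (negPf mi) (negPf mj) (negPf mh).
have [hi' hj'] : i != h /\ j != h by rewrite ![_ == h]eq_sym.
have xc : x = c + ((3 * bcoord h x - 1) / 2) *: (vertex h - c).
  apply: bcoord_inj => m; rewrite bcoord_line cE bcoord_vertex.
  have := s1 x; move: lx; rewrite /l => lx sx.
  by have := ijo m; rewrite !inE => /or3P[] /eqP ->;
    rewrite ?eqxx ?(negPf hi') ?(negPf hj')/=; lra.
rewrite xc; apply: (Pd_eq0_line Pe) => t /andP[t0 t1].
apply: edge; rewrite /l !bcoord_line !cE !bcoord_vertex ?eqxx (negPf hi') ?(negPf hj')/=;
  lra.
Qed.

(** * The symmetrized pieces coincide *)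

Section Symmetrization.
Context (r : nat) (g : 'I_3 -> R * R -> R) (e : 'I_3 -> 'I_3 -> R * R -> R).
Context (r_gt0 : (0 < r)%N).
Context (Pe : forall i j, i != j -> Pd r (e i j)).
Context (gE : forall i j x, i != j ->
  g i x - g j x = (bcoord i x - bcoord j x) ^+ (2 * r) * e i j x).

(** The piece numbered [i] of the symmetrized spline: [vertex_map s] sends the
    subtriangle numbered [i] to the one numbered [s i]. *)
Definition symmetrized (i : 'I_3) (x : R * R) : R :=
  \sum_(s : 'S_3) g (s i) (vertex_map s x).

Lemma symmetrized_vertex_map (s : 'S_3) i x :
  symmetrized (s i) (vertex_map s x) = symmetrized i x.
Proof.
rewrite [RHS](reindex_inj (mulgI s))/=; apply: eq_bigr => s' _.
by rewrite vertex_mapM permM.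
Qed.

(** The extra factor comes from antisymmetry under the exchange of [i] and [j]:
    the average [E'] of the cofactor [E] and of minus its reflection is still a
    cofactor because [2r] is even, and it vanishes on the axis of the
    reflection. *)
Lemma symmetrized_sub i j : i != j -> exists2 f, Pd r.-1 f & forall x,
  symmetrized i x - symmetrized j x = (bcoord i x - bcoord j x) ^+ (2 * r).+1 * f x.
Proof.
move=> ij; pose l x := bcoord i x - bcoord j x; pose S := vertex_map (tperm i j).
have sij (s : 'S_3) : s i != s j by rewrite (inj_eq perm_inj).
pose E x := \sum_(s : 'S_3) e (s i) (s j) (vertex_map s x).
have PE : Pd r E.
  apply: (@Pd_sum R r _ _ _ (fun (s : 'S_3) x => e (s i) (s j) (vertex_map s x))).
  by move=> s _; apply: (Pd_comp (affine_vertex_map s)); exact: Pe.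
have HE x : symmetrized i x - symmetrized j x = l x ^+ (2 * r) * E x.
  rewrite /symmetrized -sumrB mulr_sumr; apply: eq_bigr => s _.
  by rewrite gE// !bcoord_vertex_map.
have lS x : l (S x) = - l x.
  have := bcoord_vertex_map (tperm i j) i x.
  have := bcoord_vertex_map (tperm i j) j x.
  by rewrite tpermL tpermR /l /S => -> ->; rewrite opprB.
have HS x : symmetrized i (S x) - symmetrized j (S x) =
    - (symmetrized i x - symmetrized j x).
  have := symmetrized_vertex_map (tperm i j) i x.
  have := symmetrized_vertex_map (tperm i j) j x.
  by rewrite tpermL tpermR /S => -> ->; rewrite opprB.
pose E' x := 2^-1 * (E x - E (S x)).
have PE' : Pd r.-1.+1 E'.
  by rewrite prednK//; apply/PdZ/PdB => //; exact: (Pd_comp (affine_vertex_map _)).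
have Pl : Pd 1 l by apply: PdB; exact: Pd_bcoord.
have HE' x : symmetrized i x - symmetrized j x = l x ^+ (2 * r) * E' x.
  rewrite /E'; have := HS x; rewrite !HE lS exprM sqrrN -exprM => HSx.
  rewrite mulrCA mulrBr [X in _ - X](_ : _ = - (l x ^+ (2 * r) * E x)); last first.
    by rewrite -HSx.
  by field.
have E'0 x : l x = 0 -> E' x = 0.
  move=> lx; rewrite /E' /S vertex_map_tperm// -/(l x) lx scale0r addr0.
  by rewrite subrr mulr0.
have ln x : l (x - l x *: (2^-1 *: (vertex i - vertex j))) = 0.
  rewrite scalerA -scaleNr /l !bcoord_line !bcoord_vertex.
  have ji : j != i by rewrite eq_sym.
  by rewrite !eqxx (negPf ij) (negPf ji)/=; field.
have [f Pf fE] := Pd_div Pl ln PE' E'0.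
by exists f => // x; rewrite HE' fE exprSr mulrA.
Qed.

(** If [bcoord i - bcoord j] vanishes at [x] the previous lemma concludes.
    Otherwise the line through [x] on which this form is constant crosses the
    zero lines of the two other forms at the distinct parameters [a] and [b], and
    the relation between the three differences along it is
    excluded by [three_powers_eq0]. *)
Lemma symmetrized_eq i j x : symmetrized i x = symmetrized j x.
Proof.
have [->//|ij] := eqVneq i j; apply/eqP; rewrite -subr_eq0; apply/eqP.
have [h [hi hj ijh]] := third_index ij.
have [jh ih] : j != h /\ i != h by rewrite ![_ == h]eq_sym.
have [f1 Pf1 f1E] := symmetrized_sub ij.
have [f2 Pf2 f2E] := symmetrized_sub jh.
have [f3 Pf3 f3E] := symmetrized_sub hi.
set c := bcoord i x - bcoord j x.
have [c0|c0] := eqVneq c 0; first by rewrite f1E -/c c0 expr0n mul0r.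
(* along [w] the three coordinates vary by [1], [1] and [-2] *)
pose w : R * R := (vertex i - vertex h) + (vertex j - vertex h).
have wE m t : bcoord m (x + t *: w) =
    bcoord m x + t * ((m == i)%:R + (m == j)%:R - 2 * (m == h)%:R).
  rewrite /w scalerDr addrA !bcoord_line !bcoord_vertex; ring.
have [wi wj wh] : [/\ forall t, bcoord i (x + t *: w) = bcoord i x + t,
    forall t, bcoord j (x + t *: w) = bcoord j x + t &
    forall t, bcoord h (x + t *: w) = bcoord h x - 2 * t].
  have ji : j != i by rewrite eq_sym.
  split=> t; rewrite wE eqxx ?(negPf ij) ?(negPf ih) ?(negPf ji) ?(negPf jh)
    ?(negPf hi) ?(negPf hj)/=; ring.
pose a := - (bcoord j x - bcoord h x) / 3.
pose b := (bcoord h x - bcoord i x) / 3.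
have ab : a != b.
  by apply/eqP => ab; move/eqP: c0; apply; move: ab; rewrite /a /b /c; lra.
have [F1 sF1 F1E] := Pd_line x w Pf1.
have [F2 sF2 F2E] := Pd_line x w Pf2.
have [F3 sF3 F3E] := Pd_line x w Pf3.
rewrite prednK// in sF1 sF2 sF3.
pose n := (2 * r).+1.
have F1_0 : c ^+ n *: F1 = 0.
  apply: (three_powers_eq0 ab (A := 3 ^+ n *: F2) (B := (- 3) ^+ n *: F3)).
  - exact: leq_trans (size_scale_leq _ _) sF2.
  - exact: leq_trans (size_scale_leq _ _) sF3.
  - exact: leq_trans (size_scale_leq _ _) sF1.
  apply: poly_eq0_itv => t _; rewrite !hornerE -F1E -F2E -F3E -/n.
  have := f1E (x + t *: w); have := f2E (x + t *: w); have := f3E (x + t *: w).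
  rewrite -/n !wi !wj !wh.
  have -> : bcoord h x - 2 * t - (bcoord i x + t) = - 3 * (t - b).
    by rewrite /b; field.
  have -> : bcoord j x + t - (bcoord h x - 2 * t) = 3 * (t - a).
    by rewrite /a; field.
  have -> : bcoord i x + t - (bcoord j x + t) = c by rewrite /c; ring.
  rewrite !exprMn => e3 e2 e1.
  transitivity (c ^+ n * f1 (x + t *: w) + 3 ^+ n * (t - a) ^+ n * f2 (x + t *: w)
    + (- 3) ^+ n * (t - b) ^+ n * f3 (x + t *: w)).
    move: (c ^+ n) (3 ^+ n) ((- 3) ^+ n) ((t - a) ^+ n) ((t - b) ^+ n) => *.
    by rewrite /=; ring.
  by rewrite -e1 -e2 -e3; ring.
have /eqP := congr1 (fun p : {poly R} => p.[0]) F1_0.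
rewrite hornerZ horner0 -F1E scale0r addr0 => /eqP H.
by rewrite f1E -/c -/n H.
Qed.
End Symmetrization.

(** * Invariance of the integral *)

Local Notation mR := (measurableTypeR R).
Local Notation plane := (measurableTypeR R * measurableTypeR R)%type.
Local Notation leb2 := ((@lebesgue_measure R) \x (@lebesgue_measure R))%E.

Lemma measurable_Pd d f : Pd d f -> measurable_fun [set: plane] (f : plane -> mR).
Proof.
move: f; apply: Pd_ind => [|f g mf mg|c i j _]; first exact: measurable_cst.
  exact: measurable_funD.
by apply: measurable_funM; [apply: measurable_funM => //|];
  apply: measurable_funX.
Qed.

Lemma measurable_bcoord_le i (h : R * R -> R) : Pd 1 h ->
  measurable ([set x | h x <= bcoord i x] : set plane).
Proof.
move=> Ph; have mh := measurable_Pd (PdB (Pd_bcoord i) Ph).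
rewrite (_ : [set x | _] =
    setT `&` (fun x : plane => bcoord i x - h x : mR) @^-1` `[0, +oo[).
  by apply: mh => //; exact: measurable_itv.
by rewrite setTI; apply/seteqP; split => x /=; rewrite in_itv/= andbT subr_ge0.
Qed.

Lemma measurable_triangle : measurable (T : set plane).
Proof.
rewrite (_ : T = \bigcap_(i in [set: 'I_3]) [set x | 0 <= bcoord i x]).
  apply: fin_bigcap_measurable => // i _.
  exact: (measurable_bcoord_le i (Pd_cst 1 0)).
by apply/seteqP; split => x /=; rewrite triangleE => x0 i; [move=> _|]; exact: x0.
Qed.

Lemma bounded_Pd_triangle d f : Pd d f -> exists M, forall x, T x -> `|f x| <= M.
Proof.
have lam x : T x -> forall i, 0 <= bcoord i x <= 1.
  move=> /triangleE x0 i; rewrite x0/= -(sum_bcoord x) (bigD1 i)//= lerDl.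
  by apply: sumr_ge0 => k _; exact: x0.
have bnd (c : 'I_3 -> R) x : T x ->
    `|\sum_i bcoord i x * c i| <= \sum_i `|c i|.
  move=> Tx; rewrite (le_trans (ler_norm_sum _ _ _))// ler_sum// => i _.
  have /andP[x0 x1] := lam x Tx i.
  by rewrite normrM ger0_norm// ler_piMl.
have xE x : x.1 = \sum_i bcoord i x * (vertex i).1 /\
    x.2 = \sum_i bcoord i x * (vertex i).2.
  by have := bcoordK x; rewrite !sum_ord3 => xB; split; rewrite -{1}xB.
move: f; apply: Pd_ind => [|f g [M fM] [N gN]|c i j _].
- by exists 0 => x _; rewrite normr0.
- by exists (M + N) => x Tx; rewrite (le_trans (ler_normD _ _))// lerD ?fM ?gN.
- exists (`|c| * (\sum_i `|(vertex i).1|) ^+ i * (\sum_i `|(vertex i).2|) ^+ j).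
  move=> x Tx; have [-> ->] := xE x.
  by rewrite !normrM !normrX !ler_pM ?mulr_ge0 ?exprn_ge0// ?lerXn2r ?bnd//
    nnegrE sumr_ge0.
Qed.

Lemma triangle_finite : (leb2 T < +oo)%E.
Proof.
have [M MP] := bounded_Pd_triangle (Pd1_affine 1 0 0).
have [N NP] := bounded_Pd_triangle (Pd1_affine 0 1 0).
apply: (@le_lt_trans _ _ (leb2 (`[- M, M]%classic `*` `[- N, N]%classic))).
  apply: le_measure; rewrite ?inE; first exact: measurable_triangle.
    by apply: measurableX; exact: measurable_itv.
  move=> x Tx; have := MP x Tx; have := NP x Tx.
  by rewrite !mul1r !mul0r !addr0 add0r !ler_norml => h1 h2; split; rewrite /= in_itv.
rewrite product_measure1E; [|exact: measurable_itv|exact: measurable_itv].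
by rewrite /= !lebesgue_measure_itv/=; do 2 case: ifP => _;
  rewrite -?EFinM ?mule0 ?mul0e ?ltry.
Qed.

(** Measurability is asked on the whole plane so that change of variables
    applies. A spline, whose values outside the triangle are arbitrary, is
    first extended by zero. *)
Definition tame (f : R * R -> R) :=
  measurable_fun [set: plane] (f : plane -> mR) /\
  exists M, forall x, T x -> `|f x| <= M.

Lemma tame_integrable f : tame f -> leb2.-integrable T (EFin \o f).
Proof.
move=> [mf [M fM]]; apply: measurable_bounded_integrable.
- exact: measurable_triangle.
- exact: triangle_finite.
- exact: measurable_funS mf.
- exists M; split; first exact: num_real.
  by move=> N MN x Tx; exact: le_trans (fM x Tx) (ltW MN).
Qed.

Lemma tame_vertex_map s f : tame f -> tame (f \o vertex_map s).
Proof.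
move=> [mf [M fM]]; split.
  exact: measurableT_comp mf (area_preserving_vertex_map s).1.
by exists M => x Tx; apply: fM; rewrite triangle_vertex_map.
Qed.

Lemma integral_vertex_map s f : tame f ->
  integral2 T (f \o vertex_map s) = integral2 T f.
Proof.
move=> tf; have [mS SE] := area_preserving_vertex_map s.
have TS : vertex_map s @^-1` T = T.
  by apply/seteqP; split => x /=; rewrite triangle_vertex_map.
rewrite /integral2 /Rintegral; congr fine.
transitivity (\int[pushforward leb2 (vertex_map s : plane -> plane)]_(x in T)
    (f x)%:E)%E; last first.
  by apply: eq_measure_integral => A mA _; exact: SE.
rewrite (@integral_pushforward _ _ _ _ _ _ mS _ T (EFin \o f)) ?TS//.
- by apply/measurable_EFinP; exact: tf.1.
- exact: tame_integrable (tame_vertex_map s tf).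
- exact: measurable_triangle.
Qed.

Lemma integral_sum_tame (I : Type) (r : seq I) (F : I -> R * R -> R) :
  (forall i, tame (F i)) ->
  integral2 T (fun x => \sum_(i <- r) F i x) = \sum_(i <- r) integral2 T (F i).
Proof.
move=> tF; elim: r => [|i r IHr].
  rewrite big_nil /integral2 -[RHS](mul0r (fine (leb2 T))).
  rewrite -(Rintegral_cst leb2 measurable_triangle); apply: eq_Rintegral => x _.
  by rewrite big_nil.
rewrite big_cons -IHr /integral2 -RintegralD.
- by apply: eq_Rintegral => x _; rewrite big_cons.
- exact: measurable_triangle.
- exact: tame_integrable.
- have := @integrable_sum _ _ _ leb2 T measurable_triangle _ r xpredT
    (fun i => EFin \o F i) (fun i _ => tame_integrable (tF i)).
  by congr (_.-integrable _ _); apply/funext => x /=; rewrite sumEFin.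
Qed.

Lemma min_bcoord x : exists k, forall i, bcoord k x <= bcoord i x.
Proof.
case: (@arg_minP _ R _ ord0 xpredT (bcoord^~ x) isT) => k _ kmin.
by exists k => i; exact: kmin.
Qed.

Lemma tame_pieces d f (g : 'I_3 -> R * R -> R) : (forall k, Pd d (g k)) ->
  (forall k x, (forall i, 0 <= bcoord k x <= bcoord i x) -> f x = g k x) ->
  tame (f \_ T).
Proof.
move=> Pg fg; pose A k : set plane := [set x | forall i, 0 <= bcoord k x <= bcoord i x].
have TA : T = \bigcup_(k in [set: 'I_3]) A k.
  apply/seteqP; split => x.
    move=> /triangleE x0.
    have [k kmin] := min_bcoord x.
    by exists k => // i; rewrite x0 kmin.
  by move=> [k _ kx]; apply/triangleE => i; have /andP[/le_trans] := kx i; apply.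
split.
  suff : measurable_fun (T : set plane) (f : plane -> mR).
    exact: (measurable_restrictT (f : plane -> mR) measurable_triangle).1.
  have mA k : measurable (A k).
    rewrite (_ : A k = \bigcap_(i in [set: 'I_3])
        ([set x | 0 <= bcoord k x] `&` [set x | bcoord k x <= bcoord i x])).
      apply: fin_bigcap_measurable => // i _; apply: measurableI.
        exact: (measurable_bcoord_le k (Pd_cst 1 0)).
      exact: measurable_bcoord_le (Pd_bcoord k).
    apply/seteqP; split => x /=; first by move=> kx i _; exact/andP.
    by move=> kx i; apply/andP/(kx i I).
  have mfA k : measurable_fun (A k) (f : plane -> mR).
    apply: (@eq_measurable_fun _ _ _ _ _ (g k : plane -> mR)).
      by move=> x; rewrite inE => Ax; rewrite (fg k).
    exact: measurable_funS (measurable_Pd (Pg k)).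
  rewrite (_ : T = A ord0 `|` (A (lift ord0 ord0) `|` A (lift ord0 (lift ord0 ord0)))).
    by do 2 (apply/measurable_funU; [exact: mA|try exact: measurableU|split => //]).
  rewrite TA; apply/seteqP; split => x.
    move=> [[[|[|[|//]]] hk] _ Ax]; [left|right; left|right; right];
      by move: Ax; congr A; exact: val_inj.
  by move=> [|[]] Ax; [exists ord0|exists (lift ord0 ord0)|
    exists (lift ord0 (lift ord0 ord0))].
have /boolp.choice[M MP] : forall k, exists M, forall x, T x -> `|g k x| <= M.
  by move=> k; exact: bounded_Pd_triangle (Pg k).
exists (\sum_k `|M k|) => x Tx; rewrite patchE mem_set//.
have [k _ kx] : (\bigcup_(k in [set: 'I_3]) A k) x by rewrite -TA.
rewrite (fg k)// (le_trans (MP k x Tx))// (le_trans (ler_norm _))//.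
by rewrite (bigD1 k)//= lerDl sumr_ge0.
Qed.

(** On the subtriangle numbered [k] the sum is the symmetrized piece [k], and
    these pieces are all equal. *)
Lemma sum_vertex_map_Pd r f :
  spline_space (2 * r - 1) (3 * r) T (CT_split p1 p2 p3) f -> (0 < r)%N ->
  exists2 G, Pd (3 * r) G & forall x, T x -> \sum_s (f \_ T) (vertex_map s x) = G x.
Proof.
move=> /spline_pieces[Cf [g [Pg fg]]] r0.
have rE : (2 * r - 1).+1 = (2 * r)%N by lia.
have /boolp.choice[e eP] : forall ij : 'I_3 * 'I_3, exists e, ij.1 != ij.2 ->
    Pd r e /\ forall x, g ij.1 x - g ij.2 x =
      (bcoord ij.1 x - bcoord ij.2 x) ^+ (2 * r) * e x.
  move=> [i j] /=; have [_|ij] := eqVneq i j; first by exists (fun=> 0).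
  have [|e Pe eE] := smooth_division ij _ Pg Cf fg; first by lia.
  by exists e => _; move: Pe eE; rewrite rE (_ : (3 * r - 2 * r)%N = r) //; lia.
pose G := symmetrized g ord0.
have symE i j x := symmetrized_eq (g := g) (e := fun i j => e (i, j)) r0
  (fun i j ij => (eP (i, j) ij).1) (fun i j x ij => (eP (i, j) ij).2 x) i j x.
exists G.
  apply: (@Pd_sum R (3 * r) _ _ _ (fun (s : 'S_3) x => g (s ord0) (vertex_map s x))).
  by move=> s _; apply: (Pd_comp (affine_vertex_map s)); exact: Pg.
move=> x Tx.
have [k kmin] := min_bcoord x.
rewrite /G (symE _ k); apply: eq_bigr => s _.
rewrite patchE mem_set; last by rewrite triangle_vertex_map.
apply: fg => i; rewrite bcoord_vertex_map -(permKV s i) bcoord_vertex_map kmin// andbT.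
by move: Tx => /triangleE.
Qed.
End Barycentric.

(** * Exactness on splines *)

Theorem theorem3p4 (R : realType) (r : nat) (p1 p2 p3 : R * R)
    (n0 n1 n2 : nat) (Q : (R * R -> R) -> R)
    (hr : (1 <= r)%N)
    (hT : nondegenerate_triangle p1 p2 p3)
    (hQ : symmetric_rule p1 p2 p3 n0 n1 n2 Q)
    (hexact : exact_on Q (triangle p1 p2 p3) (Pd (3 * r))) :
  exact_on Q (triangle p1 p2 p3)
    (spline_space (2 * r - 1) (3 * r) (triangle p1 p2 p3)
       (CT_split p1 p2 p3)).
Proof.
move=> f sf; set T := triangle p1 p2 p3; pose f0 := f \_ T.
have f0E x : T x -> f0 x = f x by move=> Tx; rewrite /f0 patchE mem_set.
have tf0 : tame p1 p2 p3 f0.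
  by have [_ [g [Pg fg]]] := spline_pieces hT sf; exact: (tame_pieces hT Pg fg).
have [G PG GE] := sum_vertex_map_Pd hT sf hr.
rewrite (rule_eq_on hQ (g := f0)); last by move=> x /f0E.
have -> : integral2 T f = integral2 T f0.
  by apply: eq_Rintegral => x; rewrite inE => /f0E.
have : Q (fun x => \sum_(s : 'S_3) (f0 \o vertex_map p1 p2 p3 s) x) =
    integral2 T (fun x => \sum_(s : 'S_3) (f0 \o vertex_map p1 p2 p3 s) x).
  rewrite (rule_eq_on hQ (g := G)) ?hexact//.
  by apply: eq_Rintegral => x; rewrite inE => /GE.
rewrite (rule_sum hQ) (integral_sum_tame hT); last first.
  by move=> s; exact: tame_vertex_map.
rewrite (eq_bigr _ (fun s _ => rule_vertex_map hT hQ s f0)).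
rewrite [in RHS](eq_bigr _ (fun s _ => integral_vertex_map hT s tf0)).
rewrite !sumr_const => /eqP; rewrite -subr_eq0 -mulrnBl mulrn_eq0 subr_eq0.
by rewrite -leqn0 leqNgt cardT -cardE => /orP[/negP[]|/eqP//]; apply/card_gt0P; exists 1%g.
Qed.
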